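(* For each $p>0$, $$\mathbb{L}^p_c=\Big\{X\in\mathbb{L}^p: X\text{ has a quasi-continuous version and }\lim_{n\to\infty}\mathbb{E}\big[|X|^p\mathbf{1}_{\{|X|>n\}}\big]=0\Big\}.$$
   Context: $\Omega$ is a complete separable metric space with Borel $\sigma$-algebra $\mathscr{B}(\Omega)$, and $\mathscr{P}$ is a given nonempty set of probability measures on $(\Omega,\mathscr{B}(\Omega))$. $L^0(\Omega)$ is the space of real Borel functions on $\Omega$, and $C_b(\Omega)$ the bounded continuous ones. For $A\in\mathscr{B}(\Omega)$, $c(A):=\sup_{P\in\mathscr{P}}P(A)$. A Borel set $A$ is polar if $c(A)=0$, and a property holds quasi-surely (q.s.) if it holds outside a polar set. For $X\in L^0(\Omega)$ such that $E_P[X]$ exists for each $P\in\mathscr{P}$, $\mathbb{E}[X]:=\sup_{P\in\mathscr{P}}E_P[X]$. For $p>0$, $\mathcal{L}^p=\{X\in L^0(\Omega):\mathbb{E}[|X|^p]<\infty\}$, $\mathcal{N}=\{X\in L^0(\Omega):X=0\text{ q.s.}\}$, $\mathbb{L}^p=\mathcal{L}^p/\mathcal{N}$ (classes are not distinguished from representatives). $\mathbb{L}^p$ is a Banach space under $\|X\|_p=(\mathbb{E}[|X|^p])^{1/p}$ if $p\ge1$, and a complete metric space under $d(X,Y)=\mathbb{E}[|X-Y|^p]$ if $p<1$. $\mathbb{L}^p_c$ is the completion of $C_b(\Omega)$ with respect to this distance, i.e. the closure in $\mathbb{L}^p$ of (the image of) $C_b(\Omega)$. A map $X$ on $\Omega$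 with values in a topological space is quasi-continuous if for every $\varepsilon>0$ there is an open set $O$ with $c(O)<\varepsilon$ such that $X|_{O^c}$ is continuous. $X:\Omega\to\mathbb{R}$ has a quasi-continuous version if there is a quasi-continuous $Y:\Omega\to\mathbb{R}$ with $X=Y$ q.s. *)

(* Defs.v *)
From HB Require Import structures.
From mathcomp Require Import all_boot all_order all_algebra.
From mathcomp Require Import all_classical all_reals all_analysis.
From mathcomp Require Import measurable_realfun.

Set Implicit Arguments.
Unset Strict Implicit.
Unset Printing Implicit Defensive.

Import Order.TTheory GRing.Theory Num.Theory.
Import numFieldNormedType.Exports.

Local Open Scope classical_set_scope.
Local Open Scope ring_scope.

(* [Complete] carries a base point; the nonemptiness it adds is already forced
   by the existence of a probability measure on the space. *)
#[short(type="completeMetricType")]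
HB.structure Definition CompleteMetric (R : numDomainType) :=
  { T of Metric R T & Complete T }.

Definition separable (T : topologicalType) : Prop :=
  exists2 D : set T, countable D & dense D.

Notation borel T := (g_sigma_algebraType (@open T)).

Section upper_expectation.
Local Open Scope ereal_scope.
Context {R : realType} {Omega : completeMetricType R}.
Variable PP : set (probability (borel Omega) R).

Definition capacity (A : set (borel Omega)) : \bar R :=
  ereal_sup [set P A | P in PP].

Definition polar (A : set (borel Omega)) : Prop :=
  measurable A /\ capacity A = 0.

Definition quasi_surely (Q : Omega -> Prop) : Prop :=
  exists2 A : set Omega, polar A & forall w, ~ A w -> Q w.

(* Only meaningful when E_P[X] exists for every P in PP; it is applied below
   to nonnegative Borel functions only. *)
Definition upper_expectation (X : borel Omega -> R) : \bar R :=
  ereal_sup [set 'E_P[X] | P in PP].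

(* [{within A, continuous f}] is continuity of the restriction of f to A for
   the subspace topology. *)
Definition quasi_continuous (S : topologicalType) (f : Omega -> S) : Prop :=
  forall e : R, (0 < e)%R ->
    exists O : set Omega,
      [/\ open O, capacity O < e%:E & {within ~` O, continuous f}].

Definition has_quasi_continuous_version (X : Omega -> R) : Prop :=
  exists2 Y : Omega -> R, quasi_continuous Y & quasi_surely (fun w => X w = Y w).

End upper_expectation.

Notation L0 Omega R := {mfun borel Omega >-> R}.

Section spaces.
Context {R : realType} {Omega : completeMetricType R}.
Variable PP : set (probability (borel Omega) R).

Definition calLp (p : R) : set (L0 Omega R) :=
  [set X | (upper_expectation PP (fun w => (`|X w| `^ p)%R) < +oo)%E].

Definition calN : set (L0 Omega R) :=
  [set X | quasi_surely PP (fun w => X w = 0)].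

Definition Cb : set (L0 Omega R) :=
  [set X | continuous (X : Omega -> R) /\
           exists M : R, forall w : Omega, `|X w| <= M].

(* Nonemptiness is needed for equality modulo calN to be reflexive: over an
   empty family every capacity is -oo and no set is polar. *)
Hypothesis PP0 : PP !=set0.

Definition qs_eq_op (X Y : L0 Omega R) : bool := `[< calN (X - Y) >].

Lemma capacity_ge0 (A : set (borel Omega)) : (0 <= capacity PP A)%E.
Proof.
have [P PPP] := PP0; apply: le_trans (measure_ge0 P A) _.
by apply: ereal_sup_ubound; exists P.
Qed.

Lemma polar0 : polar PP set0.
Proof.
split => //; apply/eqP; rewrite eq_le capacity_ge0 andbT.
by apply: ge_ereal_sup => _ [P _ <-]; rewrite measure0.
Qed.

Lemma polarU (A B : set (borel Omega)) :
  polar PP A -> polar PP B -> polar PP (A `|` B).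
Proof.
move=> [mA cA] [mB cB]; split; first exact: measurableU.
apply/eqP; rewrite eq_le capacity_ge0 andbT.
apply: ge_ereal_sup => _ [P PPP <-].
apply: (le_trans (measureU2 _ mA mB)); rewrite -[leRHS]adde0.
by apply: leeD; [rewrite -cA|rewrite -cB]; apply: ereal_sup_ubound; exists P.
Qed.

Let qs_eq_op_refl : reflexive qs_eq_op.
Proof.
move=> X; apply/asboolP; exists set0; first exact: polar0.
by move=> w _; rewrite subrr.
Qed.

Let qs_eq_op_sym : symmetric qs_eq_op.
Proof.
suff H X Y : qs_eq_op X Y -> qs_eq_op Y X by move=> X Y; apply/idP/idP; exact: H.
move=> /asboolP[A pA XY]; apply/asboolP; exists A => // w /XY XYw.
have -> : (Y - X) w = - (X - Y) w by rewrite !mfunB /= opprB.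
by rewrite XYw oppr0.
Qed.

Let qs_eq_op_trans : transitive qs_eq_op.
Proof.
move=> Y X Z /asboolP[A pA XY] /asboolP[B pB YZ]; apply/asboolP.
exists (A `|` B); first exact: polarU.
move=> w /not_orP[/XY XYw /YZ YZw].
have -> : (X - Z) w = (X - Y) w + (Y - Z) w by rewrite !mfunB /= subrKA.
by rewrite XYw YZw addr0.
Qed.

Canonical qs_eq_op_canonical :=
  EquivRel qs_eq_op qs_eq_op_refl qs_eq_op_sym qs_eq_op_trans.

Local Open Scope quotient_scope.

(* The quotient of L0 by calN; the spaces below are subsets of it. *)
Definition qsL0 : Type := {eq_quot qs_eq_op}.
HB.instance Definition _ := Choice.on qsL0.
HB.instance Definition _ := EqQuotient.on qsL0.

(* A class is identified with a representative when used as a function. *)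
Definition fun_of_qsL0 (x : qsL0) : L0 Omega R := repr x.
Coercion fun_of_qsL0 : qsL0 >-> MeasurableFun.type.

Definition Lp (p : R) : set qsL0 := [set \pi_qsL0 X | X in calLp p].

Definition Lp_dist (p : R) (x y : qsL0) : \bar R :=
  let I := upper_expectation PP (fun w => `|x w - y w| `^ p) in
  if 1 <= p then (I `^ p^-1)%E else I.

(* Closure, in Lp for the distance Lp_dist, of the image of Cb. *)
Definition Lpc (p : R) : set qsL0 :=
  [set x | Lp p x /\
    forall e : R, 0 < e ->
      exists2 X, Cb X & (Lp_dist p x (\pi_qsL0 X) < e%:E)%E].

Lemma qsL0_reprE (X : L0 Omega R) :
  quasi_surely PP (fun w => (\pi_qsL0 X : qsL0) w = X w).
Proof.
have /eqP := reprK (\pi_qsL0 X); rewrite eqmodE => /asboolP[A pA XA].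
by exists A => // w /XA XAw; apply/eqP; rewrite -subr_eq0; apply/eqP.
Qed.

Lemma eq_upper_expectation (X Y : borel Omega -> R) :
  measurable_fun setT X -> measurable_fun setT Y ->
  quasi_surely PP (fun w => X w = Y w) ->
  upper_expectation PP X = upper_expectation PP Y.
Proof.
move=> mX mY [A [mA cA] XY]; congr ereal_sup; apply: eq_imagel => P PPP.
rewrite unlock; apply: ae_eq_integral => //.
- exact/measurable_EFinP.
- exact/measurable_EFinP.
exists A; split => //; last first.
  by move=> w /= Hw; apply: contrapT => /XY E; apply: Hw => _; rewrite E.
apply/eqP; rewrite eq_le measure_ge0 andbT -cA.
by apply: ereal_sup_ubound; exists P.
Qed.

Lemma Lp_distE (p : R) (X Y : L0 Omega R) :
  Lp_dist p (\pi_qsL0 X) (\pi_qsL0 Y) =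
  let I := upper_expectation PP (fun w => `|X w - Y w| `^ p) in
  if 1 <= p then (I `^ p^-1)%E else I.
Proof.
have mf (U V : L0 Omega R) : measurable_fun setT (fun w => `|U w - V w| `^ p).
  apply: (measurableT_comp (measurable_powR p)).
  by apply: measurableT_comp => //; exact: measurable_funB.
rewrite /Lp_dist (@eq_upper_expectation _ (fun w => `|X w - Y w| `^ p)) //.
have [A pA HX] := qsL0_reprE X; have [B pB HY] := qsL0_reprE Y.
exists (A `|` B); first exact: polarU.
by move=> w /not_orP[/HX -> /HY ->].
Qed.

End spaces.

Arguments Lp {R Omega PP} PP0 p.
Arguments Lp_dist {R Omega PP} PP0 p x y.
Arguments Lpc {R Omega PP} PP0 p.

(* Main.v *)
Require Import Defs.
From mathcomp Require Import all_boot all_order all_algebra.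
From mathcomp Require Import all_classical all_reals all_analysis.
From mathcomp Require Import measurable_realfun lra.
Import Order.TTheory GRing.Theory Num.Theory.
Import numFieldNormedType.Exports.
Local Open Scope classical_set_scope.
Local Open Scope ring_scope.

(* Convergence in the distance is convergence of E|X - Z|^p. If Z_n in Cb
   converges to X fast enough, Markov's inequality and Borel-Cantelli for the
   capacity give Z_n -> X q.s., and off open sets of small capacity the Z_n are
   uniformly Cauchy, so that lim Z_n is a quasi-continuous version of X; the
   tail condition holds since |X| > n >= 2 sup |Z| forces |X| <= 2 |X - Z|.
   Conversely, truncate X at level n and replace the truncation by a Tietze
   extension Z of its restriction to the complement of an open set O of small
   capacity; up to a polar set,
     |X - Z|^p <= 2^p |X|^p 1_{|X| > n} + (2n)^p 1_O. *)

Set Implicit Arguments.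
Unset Strict Implicit.

(** * Monotonicity, subadditivity and Markov's inequality for the sublinear expectation *)

Section upper_expectation_theory.
Context {R : realType} {Omega : completeMetricType R}.
Variable PP : set (probability (borel Omega) R).
Implicit Types (f g : borel Omega -> R) (A B : set (borel Omega)).

Lemma continuous_measurable_borel (f : Omega -> R) :
  continuous f -> measurable_fun [set: borel Omega] f.
Proof.
move=> /continuousP cf; apply: (measurability _ (RGenOpens.measurableE R)).
move=> _ [_ [a [b ->] <-]]; rewrite setTI; apply: sub_sigma_algebra.
exact/cf/interval_open.
Qed.

Lemma measurable_lt_norm f (a : R) : measurable_fun setT f ->
  measurable [set w | a < `|f w|].
Proof.
move=> mf; have mnf : measurable_fun setT (Num.norm \o f).
  exact: measurableT_comp.
rewrite [X in measurable X](_ : _ = (Num.norm \o f) @^-1` `]a, +oo[).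
  by rewrite -[X in measurable X]setTI; exact: mnf.
by apply/seteqP; split => w /=; rewrite in_itv/= andbT.
Qed.

Lemma le_upper_expectation f g :
  measurable_fun setT f -> measurable_fun setT g -> (forall w, 0 <= f w) ->
  (forall w, f w <= g w) -> (upper_expectation PP f <= upper_expectation PP g)%E.
Proof.
move=> mf mg f0 fg; apply: ge_ereal_sup => _ [P PPP <-].
apply: (@le_trans _ _ 'E_P[g]%E); last by apply: ereal_sup_ubound; exists P.
apply: expectation_le => //; last exact: aeW.
by move=> w; exact: le_trans (fg w).
Qed.

Lemma upper_expectationD_le f g :
  measurable_fun setT f -> measurable_fun setT g ->
  (forall w, 0 <= f w) -> (forall w, 0 <= g w) ->
  (upper_expectation PP (fun w => f w + g w)%R <=
   upper_expectation PP f + upper_expectation PP g)%E.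
Proof.
move=> mf mg f0 g0; apply: ge_ereal_sup => _ [P PPP <-].
apply: (@le_trans _ _ ('E_P[f] + 'E_P[g])%E); last first.
  by apply: leeD; apply: ereal_sup_ubound; exists P.
rewrite unlock -ge0_integralD//.
- by move=> w _; rewrite lee_fin.
- exact/measurable_EFinP.
- by move=> w _; rewrite lee_fin.
- exact/measurable_EFinP.
Qed.

Lemma upper_expectationZl_le (k : R) f :
  0 <= k -> measurable_fun setT f -> (forall w, 0 <= f w) ->
  (upper_expectation PP (fun w => k * f w)%R <= k%:E * upper_expectation PP f)%E.
Proof.
move=> k0 mf f0; apply: ge_ereal_sup => _ [P PPP <-].
apply: (@le_trans _ _ (k%:E * 'E_P[f])%E); last first.
  by apply: lee_wpmul2l; rewrite ?lee_fin//; apply: ereal_sup_ubound; exists P.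
rewrite unlock -ge0_integralZl_EFin//.
- by move=> w _; rewrite lee_fin.
- exact/measurable_EFinP.
Qed.

Lemma upper_expectation_indic A : measurable A ->
  upper_expectation PP \1_A = capacity PP A.
Proof.
by move=> mA; congr ereal_sup; apply: eq_imagel => P _; exact: expectation_indic.
Qed.

Lemma le_capacity A B : measurable A -> measurable B -> A `<=` B ->
  (capacity PP A <= capacity PP B)%E.
Proof.
move=> mA mB AB; apply: ge_ereal_sup => _ [P PPP <-].
apply: (@le_trans _ _ (P B)); last by apply: ereal_sup_ubound; exists P.
by apply: le_measure => //; rewrite inE.
Qed.

Lemma capacityU_le A B : measurable A -> measurable B ->
  (capacity PP (A `|` B) <= capacity PP A + capacity PP B)%E.
Proof.
move=> mA mB; apply: ge_ereal_sup => _ [P PPP <-].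
by apply: (le_trans (measureU2 _ mA mB)); apply: leeD; apply: ereal_sup_ubound;
  exists P.
Qed.

(** Countable subadditivity of each P survives the supremum, because P(F k) is at most the capacity
    of F k for every k. *)
Lemma capacity_bigcup_tail_le (F : (set (borel Omega))^nat) n :
  (forall k, measurable (F k)) ->
  (capacity PP (\bigcup_(k >= n) F k) <= \sum_(n <= k <oo) capacity PP (F k))%E.
Proof.
move=> mF; apply: ge_ereal_sup => _ [P PPP <-].
apply: (@le_trans _ _ (\sum_(n <= k <oo) P (F k))%E).
  apply: measure_sigma_subadditive_tail => //; last by rewrite setC_I.
  exact: bigcup_measurable.
by apply: lee_nneseries => // k _; apply: ereal_sup_ubound; exists P.
Qed.

(** The indicator of {|f| > a} is dominated pointwise by |f|^p / a^p. *)
Lemma upper_expectation_markov f (a p : R) : 0 < a -> 0 < p ->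
  measurable_fun setT f ->
  (capacity PP [set w | (a < `|f w|)%R] <=
   (a `^ p)^-1%:E * upper_expectation PP (fun w => `|f w| `^ p)%R)%E.
Proof.
move=> a0 p0 mf; have mA := measurable_lt_norm a mf.
have mp : measurable_fun setT (fun w => `|f w| `^ p).
  apply: (measurableT_comp (measurable_powR p)).
  exact: measurableT_comp.
rewrite -upper_expectation_indic//.
have k0 : 0 <= (a `^ p)^-1 by rewrite invr_ge0 powR_ge0.
have fp0 w : 0 <= `|f w| `^ p by exact: powR_ge0.
apply: le_trans (upper_expectationZl_le k0 mp fp0).
apply: le_upper_expectation => //.
- exact: measurable_funM.
- move=> w; rewrite indicE.
  case: (boolP (w \in _)) => [|_]; last by rewrite mulr_ge0.
  rewrite inE /= => /ltW aw.
  rewrite -[leLHS](mulVf (lt0r_neq0 (powR_gt0 p a0))) ler_wpM2l//.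
  by apply: ge0_ler_powR => //; rewrite ?nnegrE// ltW.
Qed.

End upper_expectation_theory.

(** * Real sequences with geometrically small increments *)

Section limits.
Context {R : realType}.

(** Write r_n = 2^-(n+1) for [geometric 2^-1 2^-1 n]. It is summable with r_{n+1} = r_n / 2, and
    serves throughout as the rate of approximation. *)
Lemma near_geometric_half_lt (e : R) : 0 < e ->
  \forall n \near \oo, geometric 2^-1 2^-1 n < e.
Proof.
move=> e0; have h1 : `|2^-1 : R| < 1 by rewrite ger0_norm; lra.
have /cvgrPdist_lt/(_ _ e0) := cvg_geometric (2^-1) h1.
by apply: filterS => n; apply: le_lt_trans; rewrite sub0r normrN ler_norm.
Qed.

Lemma geometric_half_ge0 n : 0 <= geometric 2^-1 2^-1 n :> R.
Proof. by rewrite /= mulr_ge0 ?exprn_ge0 ?invr_ge0. Qed.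

Lemma geometric_halfS n :
  geometric 2^-1 2^-1 n.+1 = 2^-1 * geometric 2^-1 2^-1 n :> R.
Proof. by rewrite /= exprS. Qed.

Lemma eseries_geometric_half_lty :
  (\sum_(0 <= n <oo) (geometric 2^-1 2^-1 n : R)%:E < +oo)%E.
Proof.
apply: (@le_lt_trans _ _ 1%:E); last exact: ltry.
rewrite (eq_eseriesr (g := fun n => (1 / (2 ^ n.+1)%:R)%:E)); last first.
  by move=> n _; rewrite /= -exprS natrX mul1r exprVn.
exact: epsilon_trick0.
Qed.

(** Since r_{k+1} = r_k / 2, the bound r_k + r_{k+1} equals 3 (r_k - r_{k+1}), so the increments
    telescope; this is where the factor 3 comes from. The sum r_k + r_{k+1} is what the triangle
    inequality gives when z_k and z_{k+1} are r_k- and r_{k+1}-close to a common value. *)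
Lemma geometric_increments_dist (z : nat -> R) m :
  (forall k, (m <= k)%N -> `|z k.+1 - z k| <=
     geometric 2^-1 2^-1 k + geometric 2^-1 2^-1 k.+1) ->
  forall k n, (m <= k)%N -> (k <= n)%N ->
    `|z n - z k| <= 3 * geometric 2^-1 2^-1 k.
Proof.
move=> zS k n mk kn; rewrite -(subnKC kn).
suff H j : `|z (k + j)%N - z k| <=
    3 * (geometric 2^-1 2^-1 k - geometric 2^-1 2^-1 (k + j)%N).
  apply: le_trans (H _) _; rewrite ler_pM2l// gerBl.
  exact: geometric_half_ge0.
elim: j => [|j IH]; first by rewrite addn0 !subrr normr0 mulr0.
have := zS (k + j)%N (leq_trans mk (leq_addr _ _)).
rewrite addnS geometric_halfS.
have := ler_normD (z (k + j).+1 - z (k + j)%N) (z (k + j)%N - z k).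
rewrite subrKA => h1 h2; apply: le_trans h1 _.
move: IH h2; set a := geometric _ _ k; set b := geometric _ _ (k + j)%N.
lra.
Qed.

Lemma geometric_increments_cvg (z : nat -> R) m :
  (forall k, (m <= k)%N -> `|z k.+1 - z k| <=
     geometric 2^-1 2^-1 k + geometric 2^-1 2^-1 k.+1) ->
  cvgn z.
Proof.
move=> /geometric_increments_dist zS; apply: cauchy_cvg; apply: cauchy_exP.
move=> e e0; have e3 : 0 < e / 3 by rewrite divr_gt0.
have [N _ HN] := near_geometric_half_lt e3.
exists (z (maxn m N)); exists (maxn m N) => // n /= kn.
rewrite /ball/= distrC; apply: le_lt_trans (zS _ _ (leq_maxl _ _) kn) _.
by rewrite mulrC -ltr_pdivlMr//; apply: HN; exact: leq_maxr.
Qed.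

Lemma geometric_increments_lim (z : nat -> R) m :
  (forall k, (m <= k)%N -> `|z k.+1 - z k| <=
     geometric 2^-1 2^-1 k + geometric 2^-1 2^-1 k.+1) ->
  forall k, (m <= k)%N -> `|limn z - z k| <= 3 * geometric 2^-1 2^-1 k.
Proof.
move=> zS k mk; have cz := geometric_increments_cvg zS.
apply/ler_addgt0Pl => e e0.
have /cvgrPdist_le/(_ _ e0)[N _ HN] := cz.
have h := geometric_increments_dist zS mk (leq_maxl k N).
have := ler_normD (limn z - z (maxn k N)) (z (maxn k N) - z k).
rewrite subrKA => /le_trans; apply; apply: lerD => //.
exact/HN/leq_maxr.
Qed.

End limits.

(** * Quasi-continuous limits of continuous functions *)

Section quasi_continuity.
Context {R : realType} {Omega : completeMetricType R}.
Variable PP : set (probability (borel Omega) R).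

(** On A the convergence is uniform, with error at most 3 r_k, so the usual e/3 argument applies
    with one continuous [z k]. *)
Lemma within_continuous_geometric_limit (z : (Omega -> R)^nat) (A : set Omega) m :
  (forall n, continuous (z n)) ->
  (forall k w, (m <= k)%N -> A w -> `|z k.+1 w - z k w| <=
     geometric 2^-1 2^-1 k + geometric 2^-1 2^-1 k.+1) ->
  {within A, continuous (fun w => limn (z ^~ w))}.
Proof.
move=> cz zS; apply/subspace_continuousP => x Ax.
have zlim w : A w -> forall k, (m <= k)%N ->
    `|limn (z ^~ w) - z k w| <= 3 * geometric 2^-1 2^-1 k.
  by move=> Aw; apply: geometric_increments_lim => k mk; exact: zS.
(* With r_k < e / 9, the uniform error 3 r_k is at most e / 3. *)
apply/cvgrPdist_le => e e0; have e9 : 0 < e / 9 by rewrite divr_gt0.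
have [N _ HN] := near_geometric_half_lt e9.
pose k := maxn m N; have mk : (m <= k)%N by exact: leq_maxl.
have rk : 3 * geometric 2^-1 2^-1 k <= e / 3.
  have := HN k (leq_maxr _ _); move: (geometric _ _ k) => r /=; lra.
have e3 : 0 < e / 3 by rewrite divr_gt0.
have /cvgrPdist_le/(_ _ e3) := cz k x.
rewrite /within /=; apply: filterS => w xw Aw.
have := le_trans (zlim _ Ax k mk) rk; have := le_trans (zlim _ Aw k mk) rk.
move: xw; rewrite /from_subspace/= !ler_norml => /andP[? ?] /andP[? ?] /andP[? ?].
apply/andP; split; lra.
Qed.

Lemma measurable_open_borel (O : set Omega) : open O ->
  measurable (O : set (borel Omega)).
Proof. exact: sub_sigma_algebra. Qed.

(** Borel-Cantelli for the capacity: r_n is both the size of the error and the capacity of the set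
    where it is exceeded, so the exceptional sets are summable. *)
Lemma quasi_continuous_version_limit (X : borel Omega -> R)
    (z : (Omega -> R)^nat) :
  PP !=set0 -> measurable_fun setT X -> (forall n, continuous (z n)) ->
  (forall n, (capacity PP [set w | (geometric 2^-1 2^-1 n < `|X w - z n w|)%R]
     <= (geometric 2^-1 2^-1 n)%:E)%E) ->
  has_quasi_continuous_version PP X.
Proof.
move=> PP0 mX cz Xz.
pose D n : set (borel Omega) :=
  [set w | geometric 2^-1 2^-1 n < `|X w - z n w|].
have mD n : measurable (D n).
  apply: measurable_lt_norm; apply: measurable_funB => //.
  exact: continuous_measurable_borel.
exists (fun w => limn (z ^~ w)).
- move=> e e0.
  have Hs : (\sum_(m <= n <oo) (geometric 2^-1 2^-1 n : R)%:E @[m --> \oo] --> 0)%E.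
    apply: nneseries_tail_cvg; first exact: eseries_geometric_half_lty.
    by move=> n _; rewrite lee_fin geometric_half_ge0.
  have [m _ /(_ m (leqnn m)) Hm] : \forall m \near \oo,
      (\sum_(m <= n <oo) (geometric 2^-1 2^-1 n : R)%:E < e%:E)%E.
    by apply: (Hs [set x | (x < e%:E)%E]); apply: open_ereal_lt'; rewrite lte_fin.
  (* [D k] need not be open, as X is only Borel. [G k] involves the continuous [z] alone, hence is
     open, and it is contained in the union of [D k] and [D k.+1]. *)
  pose G k := [set w : Omega | geometric 2^-1 2^-1 k + geometric 2^-1 2^-1 k.+1
    < `|z k.+1 w - z k w|].
  have oG k : open (G k).
    have cG : continuous (fun w => `|z k.+1 w - z k w|).
      by move=> w; apply: cvg_norm; apply: cvgB; exact: cz.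
    rewrite [G k](_ : _ = (fun w => `|z k.+1 w - z k w|) @^-1`
      `]geometric 2^-1 2^-1 k + geometric 2^-1 2^-1 k.+1, +oo[).
      by move/continuousP : cG; apply; exact: interval_open.
    by apply/seteqP; split => w /=; rewrite in_itv/= andbT.
  have oO : open (\bigcup_(k >= m) G k) by exact: bigcup_open.
  exists (\bigcup_(k >= m) G k); split => //.
  + apply: le_lt_trans Hm.
    apply: (@le_trans _ _ (\sum_(m <= k <oo) capacity PP (D k))%E); last first.
      apply: lee_nneseries => [k _ _|k _]; [exact: capacity_ge0|exact: Xz].
    apply: le_trans (capacity_bigcup_tail_le PP m mD).
    apply: le_capacity.
    * exact: measurable_open_borel.
    * by apply: bigcup_measurable => k _; exact: mD.
    (* Outside all [D j] with j >= m, the triangle inequality through X w contradicts membership in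
       [G k]. *)
    move=> w [k /= mk Gk]; apply: contrapT => nD.
    have nDk j : (m <= j)%N -> `|X w - z j w| <= geometric 2^-1 2^-1 j.
      by move=> mj; rewrite leNgt; apply/negP => Dj; apply: nD; exists j.
    move: Gk; rewrite /G /= ltNge => /negP; apply.
    rewrite -(subrKA (X w)).
    apply: le_trans (ler_normD _ _) _; rewrite addrC; apply: lerD.
      exact: nDk.
    by rewrite distrC; apply: nDk; rewrite leqW.
  + apply: (within_continuous_geometric_limit (m := m)) => // k w mk Ow.
    by rewrite leNgt; apply/negP => Gk; apply: Ow; exists k.
(* For each P the sum of P(D n) is at most the sum of r_n, so the limit superior of the [D n] is
   null under every P, hence polar. *)
- have mL : measurable (lim_sup_set D).
    by apply: bigcap_measurable => // n _; exact: bigcup_measurable.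
  exists (lim_sup_set D).
    split => //; apply/eqP; rewrite eq_le capacity_ge0// andbT.
    apply: ge_ereal_sup => _ [P PPP <-].
    rewrite (lim_sup_set_cvg0 mD)//.
    apply: le_lt_trans (eseries_geometric_half_lty).
    apply: lee_nneseries => [//|n _]; apply: le_trans (Xz n).
    by apply: ereal_sup_ubound; exists P.
  move=> w nL; apply/esym/cvg_lim => //; apply/cvgrPdist_le => e e0.
  (* Off the limit superior, [w] lies in only finitely many [D k]; beyond them |X - z_k| <= r_k at
     [w]. *)
  have [n nD] : exists n, forall k, (n <= k)%N -> ~ D k w.
    apply: contrapT => H; apply: nL => n _; apply: contrapT => H'; apply: H.
    by exists n => k nk Dk; apply: H'; exists k.
  near=> k; have : ~ D k w by apply: nD; near: k; exact: nbhs_infty_ge.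
  rewrite /D /= => /negP; rewrite -leNgt => /le_trans; apply; apply: ltW.
  by near: k; exact: near_geometric_half_lt.
Unshelve. all: by end_near.
Qed.

End quasi_continuity.

(** * From the distance to the upper expectation of p-th powers *)

Section Lp_distance.
Context {R : realType} {Omega : completeMetricType R}.
Variable PP : set (probability (borel Omega) R).
Hypothesis PP0 : PP !=set0.

Lemma upper_expectation_ge0 (f : borel Omega -> R) :
  (forall w, 0 <= f w) -> (0 <= upper_expectation PP f)%E.
Proof.
move=> f0; have [P PPP] := PP0.
apply: (@le_trans _ _ 'E_P[f]%E); first exact: expectation_ge0.
by apply: ereal_sup_ubound; exists P.
Qed.

(** Both powers, a and its inverse, are monotone on [0, +oo]; the value +oo is allowed for [x]
    because an upper expectation may be infinite. *)
Lemma lt_poweR_EFin (x : \bar R) (a b : R) : (0 <= x)%E -> 0 < a -> 0 < b ->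
  (x `^ a < b%:E)%E = (x < (b `^ a^-1)%:E)%E.
Proof.
move=> x0 a0 b0.
have pos (y : \bar R) : (0 <= y)%E -> y \in `[0%E, +oo%E].
  by move=> y0; rewrite in_itv/= y0 leey.
apply/idP/idP; apply: contraTT; rewrite -!leNgt => h.
- rewrite -[leLHS](_ : (b `^ a^-1)%:E `^ a = _)%E; last first.
    by rewrite poweR_EFin -powRrM mulVf ?lt0r_neq0// powRr1// ltW.
  by apply: gt0_ler_poweR => //; rewrite ?ltW// pos// lee_fin powR_ge0.
- rewrite -poweR_EFin -[leRHS](_ : (x `^ a) `^ a^-1 = _)%E; last first.
    by rewrite -poweRrM mulfV ?lt0r_neq0// poweRe1.
  apply: gt0_ler_poweR => //; rewrite ?invr_ge0 ?ltW// pos ?poweR_ge0//.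
  by rewrite lee_fin ltW.
Qed.

(** For p < 1 the two quantities coincide. For p >= 1 the distance is the p-th root, so the
    tolerance e is traded for e^(1/p) in one direction and e^p in the other. *)
Lemma Lp_dist_approx (p : R) (x : qsL0 PP0) : 0 < p ->
  (forall e : R, 0 < e ->
    exists2 X, Cb X & (Lp_dist PP0 p x (\pi_(qsL0 PP0) X)%qT < e%:E)%E) <->
  (forall e : R, 0 < e ->
    exists2 X : L0 Omega R, Cb X &
      (upper_expectation PP (fun w => `|x w - X w| `^ p)%R < e%:E)%E).
Proof.
move=> p0.
have I0 (X : L0 Omega R) :
    (0 <= upper_expectation PP (fun w => `|x w - X w| `^ p)%R)%E.
  by apply: upper_expectation_ge0 => w; exact: powR_ge0.
have dE (X : L0 Omega R) : Lp_dist PP0 p x (\pi_(qsL0 PP0) X)%qT =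
    let I := upper_expectation PP (fun w => `|x w - X w| `^ p) in
    if 1 <= p then (I `^ p^-1)%E else I.
  (* Writing [x] as the class of its representative makes both arguments classes of functions. *)
  by rewrite -[in LHS](reprK x) Lp_distE.
split=> H e e0.
- case: (leP 1 p) => p1; last first.
    by have [X CX] := H e e0; rewrite dE /= leNgt p1 => ?; exists X.
  have [|X CX] := H (e `^ p^-1); first exact: powR_gt0.
  rewrite dE /= p1 lt_poweR_EFin ?invr_gt0 ?powR_gt0// invrK -powRrM mulVf ?lt0r_neq0//.
  by rewrite powRr1 ?ltW// => ?; exists X.
- case: (leP 1 p) => p1; last first.
    by have [X CX XI] := H e e0; exists X => //; rewrite dE /= leNgt p1.
  have [|X CX XI] := H (e `^ p); first exact: powR_gt0.
  by exists X => //; rewrite dE /= p1 lt_poweR_EFin ?invr_gt0// invrK.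
Qed.

End Lp_distance.

(** Clipping is continuous, so the clipped Y is continuous and bounded on the closed complement of
    O; Tietze's theorem in a metric, hence normal, space extends it with the same bound. The level n
    + 1 keeps that bound positive. *)
Lemma clip_continuous_extension (R : realType) (Omega : completeMetricType R)
    (Y : Omega -> R) (n : nat) (O : set Omega) :
  open O -> {within ~` O, continuous Y} ->
  exists Z : L0 Omega R, [/\ continuous (Z : Omega -> R),
    forall w : Omega, `|Z w| <= n.+1%:R &
    forall w : Omega, ~ O w ->
      Z w = Num.max (- n.+1%:R) (Num.min (Y w) n.+1%:R)].
Proof.
move=> oO cY; pose h (t : R) : R := Num.max (- n.+1%:R) (Num.min t n.+1%:R).
have ch : continuous h.
  have cmin : continuous (id \min cst n.+1%:R : R -> R).
    apply: min_fun_continuous; [by move=> ?; exact: cvg_id|exact: cst_continuous].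
  have cmax : continuous (cst (- n.+1%:R) \max (id \min cst n.+1%:R) : R -> R).
    by apply: max_fun_continuous; [exact: cst_continuous|exact: cmin].
  exact: cmax.
have hn t : `|h t| <= n.+1%:R.
  rewrite ler_norml /h le_max lexx/= ge_max ge_min lexx orbT andbT.
  by rewrite -subr_ge0 opprK addr_ge0.
have [||Z [ZE cZ Zn]] := continuous_bounded_extension (@pseudometric_normal R Omega)
    (open_closedC oO) (ltr0Sn R n) (f := h \o Y).
- by apply: within_continuous_comp => // t _; exact: ch.
- by move=> w _; exact: hn.
have mZ : measurable_fun [set: borel Omega] (Z : borel Omega -> R).
  exact: continuous_measurable_borel.
exists (MeasurableFun.Pack (MeasurableFun.Class (isMeasurableFun.Build _ _ _ _ _ mZ))).
by split => // w Ow; apply/esym/ZE/mem_set.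
Qed.

(** * The two inclusions, for a fixed representative *)

Section closure.
Context {R : realType} {Omega : completeMetricType R}.
Variable PP : set (probability (borel Omega) R).
Hypothesis PP0 : PP !=set0.
Variables (p : R) (X : L0 Omega R).
Hypothesis p_gt0 : 0 < p.

Let measurable_powRB (Y Z : borel Omega -> R) : measurable_fun setT Y ->
  measurable_fun setT Z -> measurable_fun setT (fun w => `|Y w - Z w| `^ p).
Proof.
move=> mY mZ; apply: (measurableT_comp (measurable_powR p)).
by apply: measurableT_comp => //; exact: measurable_funB.
Qed.

Let measurable_tail_powR (n : R) :
  measurable_fun setT (fun w => `|X w| `^ p * \1_[set w' | n < `|X w'|] w).
Proof.
apply: measurable_funM.
  by apply: (measurableT_comp (measurable_powR p)); exact: measurableT_comp.
exact: measurable_indic (measurable_lt_norm _ _).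
Qed.

Let tail n : \bar R := upper_expectation PP
  (fun w => `|X w| `^ p * \1_[set w' | n%:R < `|X w'|] w).

Lemma Cb_approx_quasi_continuous :
  (forall e : R, 0 < e -> exists2 Z : L0 Omega R, Cb Z &
      (upper_expectation PP (fun w => `|X w - Z w| `^ p)%R < e%:E)%E) ->
  has_quasi_continuous_version PP X.
Proof.
move=> XZ; pose r (n : nat) : R := geometric 2^-1 2^-1 n.
have r0 n : 0 < r n by rewrite /r/= mulr_gt0// ?exprn_gt0 ?invr_gt0.
(* The tolerance r_n^p r_n is chosen so that Markov's inequality at level r_n leaves exactly the
   capacity bound r_n. *)
have /choice[Z HZ] : forall n, exists Z : L0 Omega R, Cb Z /\
    (upper_expectation PP (fun w => `|X w - Z w| `^ p)%R <
     (r n `^ p * r n)%:E)%E.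
  move=> n; have [|Z CZ HZ] := XZ (r n `^ p * r n); last by exists Z.
  by rewrite mulr_gt0// powR_gt0.
apply: (@quasi_continuous_version_limit _ _ _ _ Z) => //.
  by move=> n; case: (HZ n) => -[].
move=> n; have [_ Hn] := HZ n.
have mXZ : measurable_fun setT (fun w => X w - Z n w) by exact: measurable_funB.
apply: le_trans (upper_expectation_markov PP (r0 n) p_gt0 mXZ) _.
apply: (@le_trans _ _ ((r n `^ p)^-1%:E * (r n `^ p * r n)%:E)%E).
  by apply: lee_wpmul2l; [rewrite lee_fin invr_ge0 powR_ge0|exact: ltW].
by rewrite -EFinM mulKf// lt0r_neq0// powR_gt0.
Qed.

Lemma Cb_approx_tail :
  (forall e : R, 0 < e -> exists2 Z : L0 Omega R, Cb Z &
      (upper_expectation PP (fun w => `|X w - Z w| `^ p)%R < e%:E)%E) ->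
  tail @ \oo --> 0%E.
Proof.
move=> XZ.
have tail0 n : (0 <= tail n)%E.
  by apply: upper_expectation_ge0 => // w; rewrite mulr_ge0// powR_ge0.
(* Finitely many tails may be +oo; the bound with e = 1 gives the eventual finiteness needed to pass
   to real limits. *)
suff H (e : R) : 0 < e -> \forall n \near \oo, (tail n <= e%:E)%E.
  apply/fine_cvgP; split.
    move: (H 1 ltr01); apply: filterS => n h; rewrite ge0_fin_numE//; exact: le_lt_trans h (ltry _).
  apply/cvgrPdist_le => e e0; move: (H e e0); apply: filterS => n te.
  have tf : tail n \is a fin_num by rewrite ge0_fin_numE// (le_lt_trans te)// ltry.
  rewrite sub0r normrN ger0_norm ?fine_ge0//=.
  by rewrite -lee_fin fineK.
move=> e0; have k0 : 0 < 2 `^ p :> R by exact: powR_gt0.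
(* The division by 2^p absorbs the factor coming from |X|^p <= 2^p |X - Z|^p on the tail. *)
have [|Z [cZ [M ZM]] HZ] := XZ (e / 2 `^ p); first exact: divr_gt0.
have [N _ HN] := nbhs_infty_ger (2 * M).
exists N => // n Nn; have {}HN : 2 * M <= n%:R by exact: HN.
have mXZ := measurable_powRB (measurable_funPT X) (measurable_funPT Z).
have XZ0 w : 0 <= `|X w - Z w| `^ p by exact: powR_ge0.
apply: (@le_trans _ _
    (upper_expectation PP (fun w => 2 `^ p * `|X w - Z w| `^ p)%R)).
  rewrite /tail; apply: le_upper_expectation => //.
    exact: measurable_funM.
  move=> w; rewrite indicE.
  case: (boolP (w \in _)) => [|_]; last by rewrite mulr0 mulr_ge0// ltW.
  rewrite inE /= mulr1 => nX; rewrite -powRM//.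
  apply: ge0_ler_powR; rewrite ?nnegrE ?mulr_ge0// ?ltW//.
  have := ler_normD (X w - Z w) (Z w); rewrite subrK; have := ZM w.
  move: HN nX; lra.
apply: le_trans (upper_expectationZl_le PP (ltW k0) mXZ XZ0) _.
apply: (@le_trans _ _ ((2 `^ p)%:E * (e / 2 `^ p)%:E)%E).
  by apply: lee_wpmul2l; [rewrite lee_fin ltW|exact: ltW].
by rewrite -EFinM mulrC divfK// lt0r_neq0.
Qed.

Lemma quasi_continuous_tail_Cb_approx :
  has_quasi_continuous_version PP X -> tail @ \oo --> 0%E ->
  forall e : R, 0 < e -> exists2 Z : L0 Omega R, Cb Z &
      (upper_expectation PP (fun w => `|X w - Z w| `^ p)%R < e%:E)%E.
Proof.
move=> [Y qY [A [mA cA] XY]] t0 e e0.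
have k0 : 0 < 2 `^ p :> R by exact: powR_gt0.
(* The tail term 2^p d and the term M c(O) will each be at most e / 4, for a total of at most e /
   2. *)
pose d := e / 4 / 2 `^ p; have d0 : 0 < d by rewrite !divr_gt0.
have [N _ HN] : \forall n \near \oo, (tail n < d%:E)%E.
  by apply: (t0 [set x | (x < d%:E)%E]); apply: open_ereal_lt'; rewrite lte_fin.
have {HN} tN : (tail N.+1 < d%:E)%E by apply: HN => /=.
(* [M] bounds |X - Z|^p wherever both |X| and |Z| are at most N + 1. *)
pose M : R := (2 * N.+1%:R) `^ p.
have M0 : 0 < M by rewrite powR_gt0// mulr_gt0.
have [|O [oO cO cY]] := qY (e / 4 / M); first by rewrite !divr_gt0.
have [Z [cZ ZN ZE]] := clip_continuous_extension N oO cY.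
exists Z; first by split => //; exists N.+1%:R.
have mO := measurable_open_borel oO.
(* X agrees with Y only off the polar set [A]; adding it to [O] costs no capacity. *)
have mOA : measurable (O `|` A : set (borel Omega)) by exact: measurableU.
have cOA : (capacity PP (O `|` A) <= (e / 4 / M)%:E)%E.
  by apply: le_trans (capacityU_le _ mO mA) _; rewrite cA adde0 ltW.
have mtail := measurable_tail_powR N.+1%:R.
have tail_ge0 w : 0 <= `|X w| `^ p * \1_[set w' | N.+1%:R < `|X w'|] w.
  by rewrite mulr_ge0// powR_ge0.
have mind : measurable_fun setT (\1_(O `|` A) : borel Omega -> R).
  exact: measurable_indic.
apply: (@le_lt_trans _ _ (upper_expectation PP (fun w =>
    2 `^ p * (`|X w| `^ p * \1_[set w' | N.+1%:R < `|X w'|] w) +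
    M * \1_(O `|` A) w)%R)).
  apply: le_upper_expectation.
  - exact: measurable_powRB.
  - by apply: measurable_funD; exact: measurable_funM.
  - by move=> w; exact: powR_ge0.
  move=> w; have le2p (a b : R) : 0 <= a -> a <= 2 * b -> a `^ p <= 2 `^ p * b `^ p.
    move=> a0 ab; have b0 : 0 <= b by lra.
    by rewrite -powRM//; apply: ge0_ler_powR; rewrite ?nnegrE ?mulr_ge0// ltW.
  have N0 : 0 <= N.+1%:R :> R by [].
  (* If |X| > N + 1, then |Z| <= N + 1 < |X| gives |X - Z| <= 2 |X|. *)
  rewrite !indicE; have [Xw|Xw] := ltP N.+1%:R `|X w|.
    rewrite (mem_set (Xw : [set w' | N.+1%:R < `|X w'|] w)).
    rewrite mulr1 -[leLHS]addr0; apply: lerD; last by rewrite mulr_ge0// ltW.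
    apply: le2p => //; have := ler_normB (X w) (Z w); have := ZN w.
    move: Xw; lra.
  rewrite (memNset (A := [set w' | _])) ?mulr0 ?add0r; last first.
    by move=> /=; rewrite ltNge Xw.
  have [wOA|wOA] := pselect ((O `|` A) w).
    rewrite (mem_set wOA) mulr1.
    apply: ge0_ler_powR; [exact: ltW|by rewrite nnegrE|by rewrite nnegrE mulr_ge0|].
    by have := ler_normB (X w) (Z w); have := ZN w; move: Xw; lra.
  (* Here Z is the clipped Y = X, and |X| <= N + 1 makes the clipping trivial, so X - Z = 0; its
     p-th power vanishes because p is nonzero. *)
  rewrite (memNset wOA) mulr0 ZE; last by move=> Ow; apply: wOA; left.
  rewrite -XY; last by move=> Aw; apply: wOA; right.
  move: Xw; rewrite ler_norml => /andP[? ?].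
  by rewrite min_l// max_r// subrr normr0 powR0// lt0r_neq0.
apply: le_lt_trans (upper_expectationD_le _ _ _ _ _) _.
- exact: measurable_funM.
- exact: measurable_funM.
- by move=> w; rewrite mulr_ge0// ltW.
- by move=> w; rewrite mulr_ge0// ltW.
have H1 := upper_expectationZl_le PP (ltW k0) mtail tail_ge0.
have H2 := upper_expectationZl_le PP (ltW M0) mind (fun w => ler0n _ _).
apply: le_lt_trans (leeD H1 H2) _.
rewrite upper_expectation_indic//.
apply: (@le_lt_trans _ _ ((2 `^ p)%:E * d%:E + M%:E * (e / 4 / M)%:E)%E).
  apply: leeD; apply: lee_wpmul2l => //.
  - exact: ltW.
  - by rewrite (lee_fin 0) ltW.
rewrite -!EFinM -EFinD lte_fin /d ![_ * (_ / _)]mulrC !divfK ?lt0r_neq0//.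
lra.
Qed.

End closure.

Theorem theorem25 (R : realType) (Omega : completeMetricType R)
    (hsep : separable Omega)
    (PP : set (probability (borel Omega) R)) (PP0 : PP !=set0)
    (p : R) (hp : 0 < p) :
  Lpc PP0 p =
  [set X | [/\ Lp PP0 p X,
    has_quasi_continuous_version PP X &
    upper_expectation PP
      (fun w => `|X w| `^ p * \1_[set w' | n%:R < `|X w'|] w)
      @[n --> \oo] --> 0%E]].
Proof.
apply/seteqP; split => X /=.
- move=> [XLp /(Lp_dist_approx X hp) XZ]; split => //.
  + exact: Cb_approx_quasi_continuous XZ.
  + exact: Cb_approx_tail XZ.
- move=> [XLp Xqc Xt]; split => //; apply/(Lp_dist_approx X hp).
  exact: quasi_continuous_tail_Cb_approx.
Qed.
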